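(* Let $n\ge1$. Then $$C_n^{(\mathrm{pk},\mathrm{des})}\left(\frac{(1+y)^2t}{(y+t)(1+yt)},\frac{y+t}{1+yt}\right)=\frac{1+y}{n(1+yt)^{n+1}}\sum_{d\mid n}\mu(d)\,(1-(-y)^d)^{n/d}(1-t)^{n-n/d}A_{n/d}(t).$$
   Context: For a permutation $\pi=\pi(1)\cdots\pi(n)$ of $[n]=\{1,\dots,n\}$, $\mathrm{des}(\pi)$ is the number of descents, i.e. $i\in[n-1]$ with $\pi(i)>\pi(i+1)$, and $\mathrm{pk}(\pi)$ is the number of peaks, i.e. $i\in\{2,\dots,n-1\}$ with $\pi(i-1)<\pi(i)>\pi(i+1)$. $\mathfrak{S}_n$ is the set of all permutations of $[n]$, and $\mathfrak{C}_n\subseteq\mathfrak{S}_n$ is the set of cyclic permutations (those consisting of a single cycle of length $n$). Put $$C_n^{(\mathrm{pk},\mathrm{des})}(y,t)=\sum_{\pi\in\mathfrak{C}_n}y^{\mathrm{pk}(\pi)+1}t^{\mathrm{des}(\pi)+1},\qquad A_n(t)=\sum_{\pi\in\mathfrak{S}_n}t^{\mathrm{des}(\pi)+1}\quad(n\ge1).$$ $\mu$ is the number-theoretic Möbius function. The identity is between rational functions in the variables $y,t$. *)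

(* Defs.v *)
From HB Require Import structures.
From mathcomp Require Import all_boot all_order all_fingroup all_algebra.
From mathcomp Require Import mpoly.

Set Implicit Arguments.
Unset Strict Implicit.
Unset Printing Implicit Defensive.

Import GRing.Theory.
Local Open Scope ring_scope.

(* Permutations of [n] are elements of 'S_n, so positions and values are
   shifted to {0, ..., n-1}. *)
Definition des n (s : 'S_n) : nat :=
  #|[set i : 'I_n | [exists j : 'I_n, (j == i.+1 :> nat) && (s j < s i)%N]]|.

Definition pk n (s : 'S_n) : nat :=
  #|[set i : 'I_n | [exists h : 'I_n, exists j : 'I_n,
      [&& i == h.+1 :> nat, j == i.+1 :> nat, (s h < s i)%N & (s j < s i)%N]]]|.

(* [porbits s] contains the fixed points of [s] as singletons, so a unique
   orbit has length n. *)
Definition cyclic_perm n (s : 'S_n) : bool := #|porbits s| == 1%N.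

Definition cyc_pkdes (R : comNzRingType) (n : nat) (y t : R) : R :=
  \sum_(s : 'S_n | cyclic_perm s) y ^+ (pk s).+1 * t ^+ (des s).+1.

Definition eulerian (R : comNzRingType) (n : nat) (t : R) : R :=
  \sum_(s : 'S_n) t ^+ (des s).+1.

Definition mobius (d : nat) : int :=
  if (0 < d)%N && all (fun p => logn p d == 1%N) (primes d)
  then (-1) ^+ size (primes d) else 0.

Definition ratfun2 : fieldType := {fraction {mpoly rat[2]}}.

Definition ratfun_y : ratfun2 := tofrac ('X_ord0 : {mpoly rat[2]}).
Definition ratfun_t : ratfun2 := tofrac ('X_ord_max : {mpoly rat[2]}).

(* Main.v *)
Require Import Defs.
From HB Require Import structures.
From mathcomp Require Import all_boot all_order all_fingroup all_algebra.
From mathcomp Require Import mpoly zify ring.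

(** The proof turns the pair (pk, des) into a count of words.  Take the letters
  0' < 0 < 1' < 1 < ... < (k-1)' < k-1.  A weakly increasing word of length n is
  compatible with a permutation s when two equal neighbours force an ascent of
  s if their letter is plain, and a descent if it is barred.  Let S_s(k) be the
  sum of y ^ (number of bars) over these words.  Adding one letter at a time
  gives
    (1-X)^(n+1) sum_k S_s(k) X^k
      = (1+y)^(2 pk + 1) X^(pk+1) (y+X)^(des-pk) (1+yX)^(n-1-des-pk)
  (compat_sum_series).  The right-hand side at X = t is, up to the factor
  (1+yt)^(n+1) / (1+y), the monomial of s after the substitution of the theorem
  (pkdes_substitution).  At y = 0, summing over all s and sorting words gives
  (1-X)^(m+1) sum_k k^m X^k = A_m(X) (eulerian_series).  So the theorem is
  equivalent to the following count, for every k (cyclic_compat_sum):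
    n sum_(s cyclic) S_s(k) = sum_(d | n) mu(d) (k (1 - (-y)^d))^(n/d).

  This count is a signed form of the bijection of Gessel and Reutenauer.  Each
  cyclic permutation is c^sigma, with c the cyclic shift, for exactly n
  permutations sigma (sum_conj_shift).  A word compatible with c^sigma, read
  along the cycle, is a word w whose n rotations are ranked by sigma, for the
  lexicographic order in which every barred letter reverses the comparison of
  what follows it.  It remains to count the rankings of a given w = v^e with v
  primitive.  Rotations that differ are compared in only one way.  On the e
  equal copies of a rotation, the shift by the length of v acts as a cycle of
  length e which preserves the ranks or reverses them, according to the parity
  of the number b of bars of v.  Hence e = 1, with one ranking, or e = 2 and b
  is odd, with two (card_rank_perm).  This number of rankings is
  sum_(d | e) mu(d) (-1)^(b (e/d + e)) (mobius_sign_sum), which expresses it by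
  the ways to see w as a d-th power.  Exchanging the sums leaves, for each d, a
  free sum over words of length n/d, which is the right-hand side. *)

Set Implicit Arguments.
Unset Strict Implicit.
Unset Printing Implicit Defensive.

Import GRing.Theory.
Local Open Scope ring_scope.

(** * Power series over a power of 1 - X *)

(** A rational series P / (1-X)^m is handled through its coefficient sequence a:
  multiplication by X is [delay], multiplication by 1 - X is [bdiff], and
  [series_of m P a] says that (1-X)^m times the series of a is P. *)
Definition delay (R : zmodType) (a : nat -> R) : nat -> R :=
  fun k => if k is j.+1 then a j else 0.
Definition bdiff (R : zmodType) (a : nat -> R) : nat -> R :=
  fun k => a k - delay a k.

Lemma eq_bdiff (R : zmodType) (a b : nat -> R) : a =1 b -> bdiff a =1 bdiff b.
Proof. by move=> h [|k]; rewrite /bdiff /delay !h. Qed.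

Lemma eq_iter_bdiff (R : zmodType) m (a b : nat -> R) :
  a =1 b -> iter m (@bdiff R) a =1 iter m (@bdiff R) b.
Proof. by move=> h; elim: m => //= m IH; apply: eq_bdiff. Qed.

Definition series_of (R : nzRingType) m (P : {poly R}) (a : nat -> R) : Prop :=
  iter m (@bdiff R) a =1 (fun k => P`_k).

Lemma series_ofD (R : nzRingType) m (P Q : {poly R}) a b :
  series_of m P a -> series_of m Q b -> series_of m (P + Q) (fun k => a k + b k).
Proof.
move=> ha hb k; rewrite coefD -ha -hb.
elim: m {P Q ha hb} k => //= m IH k.
rewrite (eq_bdiff IH) /bdiff; case: k => [|k] /=; rewrite ?subr0 //.
by rewrite opprD addrACA.
Qed.

Lemma series_ofZ (R : nzRingType) m (P : {poly R}) c a :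
  series_of m P a -> series_of m (c%:P * P) (fun k => c * a k).
Proof.
move=> ha k; rewrite coefCM -ha.
elim: m {P ha} k => //= m IH k.
rewrite (eq_bdiff IH) /bdiff; case: k => [|k] /=; rewrite ?subr0 //.
by rewrite mulrBr.
Qed.

Lemma series_of_delay (R : nzRingType) m (P : {poly R}) a :
  series_of m P a -> series_of m (P * 'X) (delay a).
Proof.
move=> ha k; rewrite coefMX.
have -> : iter m (@bdiff R) (delay a) k = delay (iter m (@bdiff R) a) k.
  elim: m {P ha} k => //= m IH k; rewrite (eq_bdiff IH).
  by case: k => [|[|k]] //=; rewrite /bdiff /= ?subrr ?subr0.
by case: k => [|k] //=; rewrite ha.
Qed.

Lemma series_of_bdiff (R : nzRingType) m (P : {poly R}) a :
  series_of m P (bdiff a) <-> series_of m.+1 P a.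
Proof. by rewrite /series_of iterSr. Qed.

Lemma series_ofS (R : nzRingType) m (P : {poly R}) a :
  series_of m P a -> series_of m.+1 (P * (1 - 'X)) a.
Proof.
move=> ha k /=; rewrite (eq_bdiff ha) /bdiff mulrBr mulr1 coefB coefMX.
by case: k.
Qed.

Lemma series_of_ext (R : nzRingType) m (P : {poly R}) a b :
  a =1 b -> series_of m P a -> series_of m P b.
Proof. by move=> e h k; rewrite -h; apply: eq_iter_bdiff => j; rewrite e. Qed.

Lemma series_of_inj (R : nzRingType) m (P Q : {poly R}) a :
  series_of m P a -> series_of m Q a -> P = Q.
Proof. by move=> h1 h2; apply/polyP => k; rewrite -h1 -h2. Qed.

Lemma series_of_const (R : nzRingType) (c : R) : series_of 1 c%:P (fun=> c).
Proof. by case=> [|k]; rewrite /= /bdiff /= coefC ?subr0 // subrr. Qed.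

Lemma series_of_sum (R : nzRingType) m (I : eqType) (r : seq I) (C : pred I)
    (P : I -> {poly R}) (a : I -> nat -> R) :
  (forall i, i \in r -> series_of m (P i) (a i)) ->
  series_of m (\sum_(i <- r | C i) P i) (fun k => \sum_(i <- r | C i) a i k).
Proof.
move=> h k; rewrite coef_sum [RHS]big_seq_cond.
rewrite -(eq_bigr _ (fun i ri => h i (proj1 (andP ri)) k)) -big_seq_cond.
elim: m {h} k => //= m IH k; rewrite (eq_bdiff IH) /bdiff.
by case: k => [|k]; rewrite /= ?subr0 -?sumrB //; apply: eq_bigr => i _; rewrite subr0.
Qed.

Lemma series_ofX (R : nzRingType) m j (P : {poly R}) a :
  series_of m P a -> series_of (m + j) (P * (1 - 'X) ^+ j) a.
Proof.
move=> h; elim: j => [|j IH]; first by rewrite expr0 mulr1 addn0.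
by rewrite addnS exprSr mulrA; apply: series_ofS.
Qed.

(** * Weighted words along a descent pattern *)

(** The letter with level j is coded by 2j + 1, and its barred version by 2j.
  Bars come first within a level, which is what makes an ascent followed by a
  descent, rather than the opposite, contribute a special factor below. *)
Definition barred (x : nat) : bool := ~~ odd x.

(** Two letters x, x' may follow each other across a descent (d true) or an
  ascent (d false). *)
Definition letter_step (d : bool) (x x' : nat) : bool :=
  (x < x')%N || (x == x') && (d == barred x).

Definition weight (R : comNzRingType) (y : R) n m (a : {ffun 'I_n -> 'I_m}) : R :=
  \prod_i y ^+ barred (a i).

Definition chain (D : nat -> bool) m i (a : {ffun 'I_i.+1 -> 'I_m}) : bool :=
  [forall j : 'I_i, letter_step (D j) (a (widen_ord (leqnSn i) j)) (a (lift ord0 j))].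

(** Words are extended on the right, so that sums over words of length n + 1 can
  be computed by recursion on the last letter. *)
Definition ffsnoc (A : finType) n (p : {ffun 'I_n -> A} * A) : {ffun 'I_n.+1 -> A} :=
  [ffun j => if unlift ord_max j is Some l then p.1 l else p.2].

Lemma ffsnoc_max (A : finType) n (p : {ffun 'I_n -> A} * A) :
  ffsnoc p ord_max = p.2.
Proof. by rewrite ffunE unlift_none. Qed.

Lemma ffsnoc_lift (A : finType) n (p : {ffun 'I_n -> A} * A) (j : 'I_n) :
  ffsnoc p (lift ord_max j) = p.1 j.
Proof. by rewrite ffunE liftK. Qed.

Lemma ffsnoc_lt (A : finType) n (p : {ffun 'I_n -> A} * A) (i : 'I_n.+1) (j : 'I_n) :
  i = j :> nat -> ffsnoc p i = p.1 j.
Proof.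
move=> eij; rewrite -(ffsnoc_lift p j); congr (ffsnoc p _).
by apply: val_inj; rewrite /= -[RHS]/(nat_of_ord (lift ord_max j)) lift_max.
Qed.

Lemma ffsnoc_bij (A : finType) n : bijective (@ffsnoc A n).
Proof.
exists (fun b : {ffun 'I_n.+1 -> A} =>
  ([ffun j : 'I_n => b (lift ord_max j)], b ord_max)).
  move=> [a x] /=; rewrite ffsnoc_max /=; congr pair.
  by apply/ffunP=> j; rewrite ffunE ffsnoc_lift.
move=> b; apply/ffunP=> j.
case: (unliftP ord_max j) => [l|] ->; last by rewrite ffsnoc_max.
by rewrite ffsnoc_lift ffunE.
Qed.

Lemma weight_snoc (R : comNzRingType) (y : R) n m (p : {ffun 'I_n -> 'I_m} * 'I_m) :
  weight y (ffsnoc p) = weight y p.1 * y ^+ barred p.2.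
Proof.
rewrite /weight big_ord_recr /= ffsnoc_max; congr (_ * _).
by apply: eq_bigr => i _; rewrite (ffsnoc_lt _ (j := i)).
Qed.

Lemma chain_snoc D m i (p : {ffun 'I_i.+1 -> 'I_m} * 'I_m) :
  chain D (ffsnoc p) = chain D p.1 && letter_step (D i) (p.1 ord_max) p.2.
Proof.
apply/forallP/andP => [h | [/forallP h h1] j].
  split.
    apply/forallP=> j; have := h (widen_ord (leqnSn i) j).
    rewrite (ffsnoc_lt _ (j := widen_ord (leqnSn i) j)) //.
    by rewrite (ffsnoc_lt _ (j := lift ord0 j)).
  have := h ord_max; rewrite (ffsnoc_lt _ (j := ord_max)) //.
  have -> : lift ord0 (ord_max : 'I_i.+1) = ord_max by apply: val_inj.
  by rewrite ffsnoc_max.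
case: (ltnP j i) => [ltji | leij].
  have := h (Ordinal ltji).
  rewrite (ffsnoc_lt _ (j := widen_ord (leqnSn i) (Ordinal ltji))) //.
  by rewrite (ffsnoc_lt _ (j := lift ord0 (Ordinal ltji))).
have -> : j = ord_max.
  by apply: val_inj; apply/eqP; rewrite eqn_leq leij -ltnS ltn_ord.
rewrite (ffsnoc_lt _ (j := ord_max)) //.
have -> : lift ord0 (ord_max : 'I_i.+1) = ord_max by apply: val_inj.
by rewrite ffsnoc_max.
Qed.

(** Total weight of the chains of length i + 1 that end with x.  Since earlier
  letters are at most x, this does not depend on the size of the alphabet. *)
Fixpoint last_letter_weight (R : comNzRingType) (y : R) (D : nat -> bool) i x : R :=
  if i is j.+1 then
    y ^+ barred x *
    \sum_(x' < x.+1 | letter_step (D j) x' x) last_letter_weight y D j x'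
  else y ^+ barred x.

Lemma chain_sum_last (R : comNzRingType) (y : R) D m i (x : 'I_m) :
  \sum_(a : {ffun 'I_i.+1 -> 'I_m} | chain D a && (a ord_max == x)) weight y a
  = last_letter_weight y D i x.
Proof.
elim: i x => [|i IH] x.
  rewrite (big_pred1 [ffun=> x]) ?/weight ?big_ord1 ?ffunE //= => a.
  have -> : chain D a by apply/forallP; case.
  apply/eqP/eqP => [<- | ->]; last by rewrite ffunE.
  by apply/ffunP => j; rewrite ffunE; congr (a _); apply: val_inj; case: j => [[]].
rewrite (reindex (@ffsnoc _ _)) /=; last exact: (onW_bij _ (ffsnoc_bij _ _)).
rewrite (eq_bigl (fun p : {ffun 'I_i.+1 -> 'I_m} * 'I_m =>
  (chain D p.1 && letter_step (D i) (p.1 ord_max) p.2)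
    && (p.2 == x))); last by move=> p; rewrite chain_snoc ffsnoc_max.
rewrite (eq_bigr _ (fun p _ => weight_snoc y p)).
transitivity (\sum_(a : {ffun 'I_i.+1 -> 'I_m} |
     chain D a && letter_step (D i) (a ord_max) x)
     \sum_(z | z == x) weight y a * y ^+ barred x).
  rewrite pair_big_dep /=; apply: eq_big => [[a z] /= | [a z] /= /andP[_ /eqP ->] //].
  by case: eqP => [->|]; rewrite ?andbF.
rewrite (eq_bigr (fun a => y ^+ barred x * weight y a)); last first.
  by move=> a _; rewrite big_pred1_eq mulrC.
rewrite -mulr_sumr; congr (_ * _).
rewrite (partition_big (fun a : {ffun 'I_i.+1 -> 'I_m} => a ord_max)
  (fun z : 'I_m => letter_step (D i) z x)) /=; last by move=> a /andP[].
rewrite [RHS](big_ord_widen_cond m (fun z => letter_step (D i) z x)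
   (fun z => last_letter_weight y D i z)) //.
apply: eq_big => [z | z hz].
  rewrite ltnS; apply/idP/andP=> [h|[]//]; split=> //.
  by move: h; rewrite /letter_step; case: ltngtP.
rewrite -IH; apply: eq_bigl => a; rewrite andbAC -andbA.
by case: eqP => [->|]; rewrite ?hz ?andbF ?andbT.
Qed.

Lemma chain_sum (R : comNzRingType) (y : R) D m i :
  \sum_(a : {ffun 'I_i.+1 -> 'I_m} | chain D a) weight y a
  = \sum_(x < m) last_letter_weight y D i x.
Proof.
rewrite (partition_big (fun a : {ffun 'I_i.+1 -> 'I_m} => a ord_max) xpredT) //=.
by apply: eq_bigr => x _; rewrite chain_sum_last.
Qed.

Definition level_sum (R : comNzRingType) (y : R) D i k : R :=
  \sum_(x < k.*2) last_letter_weight y D i x.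

Lemma level_sumS (R : comNzRingType) (y : R) D i k :
  level_sum y D i k.+1 = level_sum y D i k + last_letter_weight y D i k.*2
     + last_letter_weight y D i k.*2.+1.
Proof. by rewrite /level_sum doubleS !big_ord_recr. Qed.

Lemma last_letter_weightS (R : comNzRingType) (y : R) D i x :
  last_letter_weight y D i.+1 x = y ^+ barred x *
    (\sum_(z < x) last_letter_weight y D i z
      + (if D i == barred x then last_letter_weight y D i x else 0)).
Proof.
rewrite /= big_mkcond big_ord_recr /=; congr (_ * (_ + _)).
  by apply: eq_bigr => z _; rewrite /letter_step ltn_ord.
by rewrite /letter_step ltnn eqxx.
Qed.

(** The next two recurrences are the linear system satisfied by the weights u of
  plain and v of barred last letters; S denotes the sum of u + v over
  lower levels.  Ascent: u' = S + v + u and v' = y S.  Descent: u' = S + v and v' = y u'. *)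
Lemma weight_barred (R : comNzRingType) (y : R) D i k :
  last_letter_weight y D i.+1 k.*2 =
    y * (level_sum y D i k + (if D i then last_letter_weight y D i k.*2 else 0)).
Proof. by rewrite last_letter_weightS /barred odd_double /= eqb_id expr1. Qed.

Lemma weight_unbarred (R : comNzRingType) (y : R) D i k :
  last_letter_weight y D i.+1 k.*2.+1 =
    level_sum y D i k + last_letter_weight y D i k.*2
      + (if D i then 0 else last_letter_weight y D i k.*2.+1).
Proof.
rewrite last_letter_weightS /barred /= odd_double /= expr0 mul1r big_ord_recr /=.
by case: (D i).
Qed.

(** Numerators, over (1-X)^(i+1), of the generating series of the weights of
  plain and of barred last letters. *)
Fixpoint last_letter_poly (R : comNzRingType) (y : R) (D : nat -> bool) i :
    {poly R} * {poly R} :=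
  if i is j.+1 then
    let: (P, Q) := last_letter_poly y D j in
    if D j then let P' := (P + Q) * 'X + Q * (1 - 'X) in (P', y%:P * P')
    else (P + Q, y%:P * ((P + Q) * 'X))
  else (1, y%:P).

Definition total_poly (R : comNzRingType) (y : R) D i : {poly R} :=
  (last_letter_poly y D i).1 + (last_letter_poly y D i).2.

(** [level_sum] is made of the partial sums of the sequence in the hypothesis,
  delayed by one: this costs a factor X, and a factor 1 - X in the denominator. *)
Lemma level_sum_series (R : comNzRingType) (y : R) D i :
  series_of i.+1 (total_poly y D i)
    (fun k => last_letter_weight y D i k.*2.+1 + last_letter_weight y D i k.*2) ->
  series_of i.+2 (total_poly y D i * 'X) (level_sum y D i).
Proof.
move=> h; apply/series_of_bdiff; apply: series_of_ext (series_of_delay h) => k.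
rewrite /bdiff; case: k => [|k] /=.
  by rewrite /level_sum big_ord0 subr0.
by rewrite level_sumS; ring.
Qed.

Lemma last_letter_series (R : comNzRingType) (y : R) D i :
  series_of i.+1 (last_letter_poly y D i).1
    (fun k => last_letter_weight y D i k.*2.+1) /\
  series_of i.+1 (last_letter_poly y D i).2
    (fun k => last_letter_weight y D i k.*2).
Proof.
elim: i => [|i [hu hv]].
  by split; [apply: series_of_ext (series_of_const 1) |
    apply: series_of_ext (series_of_const y)] => k; rewrite /= /barred /= odd_double.
have hs := series_ofD hu hv.
have hS : series_of i.+2 (total_poly y D i * 'X) (level_sum y D i).
  exact: level_sum_series.
rewrite /total_poly in hS; move: (weight_barred y D i) (weight_unbarred y D i).
set W := last_letter_weight y D i.+1; move: W => W hb hub.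
move: hu hv hs hS => /=.
case: (last_letter_poly y D i) => P Q /= hu hv hs hS.
case: (D i) hb hub => hb hub /=.
  have hP : series_of i.+2 ((P + Q) * 'X + Q * (1 - 'X))
      (fun k => level_sum y D i k + last_letter_weight y D i k.*2).
    exact: series_ofD hS (series_ofS hv).
  split; first by apply: series_of_ext hP => k; rewrite hub addr0.
  by apply: series_of_ext (series_ofZ y hP) => k; rewrite hb.
split; last first.
  by apply: series_of_ext (series_ofZ y hS) => k; rewrite hb addr0.
apply/series_of_bdiff; apply: series_of_ext hs => -[|k].
  by rewrite /bdiff /delay hub /level_sum big_ord0; ring.
by rewrite /bdiff /delay !hub level_sumS; ring.
Qed.

(** * Peaks and descents *)

Definition peak (D : nat -> bool) j : bool := [&& (0 < j)%N, ~~ D j.-1 & D j].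

(** After an ascent, the pair (P, Q) is (P, yXP), and its total (1 + yX) P is
  1 + yX times the previous total.  After a descent, or at the start, it is
  (P, yP), with total (1 + y) P.  A descent multiplies the total by y + X,
  except after an ascent: then the factor 1 + yX just gained is replaced with
  X (1+y)^2, which is the contribution of a peak. *)
Lemma total_polyE (R : comNzRingType) (y : R) D i :
  let p := (\sum_(j < i) peak D j)%N in
  let d := (\sum_(j < i) D j)%N in
  [/\ (p <= d)%N, (d + p <= i)%N &
  total_poly y D i = (1 + y)%:P * ((1 + y) ^+ 2 *: 'X) ^+ p *
    (y%:P + 'X) ^+ (d - p) * (1 + y *: 'X) ^+ (i - d - p)].
Proof.
pose h a b c : {poly R} := (1 + y)%:P * ((1 + y) ^+ 2 *: 'X) ^+ a *
    (y%:P + 'X) ^+ b * (1 + y *: 'X) ^+ c.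
suff : exists b c, let p := (\sum_(j < i) peak D j)%N in
  let d := (\sum_(j < i) D j)%N in
  [/\ d = (p + b)%N, (d + p + c = i)%N, total_poly y D i = h p b c &
   let: (P, Q) := last_letter_poly y D i in
   if (0 < i)%N && ~~ D i.-1 then
     exists2 c', c = c'.+1 & P = h p b c' /\ Q = y *: 'X * P
   else Q = y%:P * P].
  move=> [b [c /= [ed ei -> _]]]; split; first by rewrite ed leq_addr.
    by rewrite -[X in (_ <= X)%N]ei leq_addr.
  by rewrite /h; congr (_ * _ ^+ _ * _ ^+ _); lia.
elim: i => [|i [b [c /= [ed ei]]]].
  exists 0%N, 0%N; rewrite !big_ord0 /total_poly /h /=; split=> //.
    by rewrite !expr0 !mulr1 polyCD.
  by rewrite mulr1.
rewrite /total_poly /= !big_ord_recr /=.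
move: ed ei; set d := (\sum_(j < i) D j)%N; set p := (\sum_(j < i) peak D j)%N.
move=> ed ei; rewrite /peak.
case: (last_letter_poly y D i) => P Q /=.
move=> hPQ; case: ifP => [/andP[i0 nD] [c' ec [eP eQ]] | hlast eQ].
  rewrite i0 nD /=; case: (D i) => /=; rewrite ?addn0.
    exists b, c'; split; [lia | lia | | by []].
    rewrite hPQ ec eQ eP /h exprD expr1 (exprS _ c') -!mul_polyC polyC_exp polyCD.
    set u := _ ^+ p; set v := _ ^+ b; set w := _ ^+ c'; ring.
  exists b, c.+1; split; [lia | lia | |
    by exists c; rewrite // hPQ -mul_polyC; split=> //; ring].
  rewrite hPQ /h (exprS _ c) -!mul_polyC.
  by set u := _ ^+ p; set v := _ ^+ b; set w := _ ^+ c; ring.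
have -> : (0 < i)%N && (~~ D i.-1 && D i) = false by rewrite andbA hlast.
rewrite addn0; case: (D i) => /=; rewrite ?addn0.
  exists b.+1, c; split; [lia | lia | | by []].
  have -> : h p b.+1 c = (y%:P + 'X) * h p b c 
    by rewrite /h (exprS _ b); set u := _ ^+ p; set v := _ ^+ b; set w := _ ^+ c; ring.
  by rewrite -hPQ eQ; ring.
exists b, c.+1; split; [lia | lia | |
    by exists c; rewrite // hPQ -mul_polyC; split=> //; ring].
rewrite hPQ /h (exprS _ c) -!mul_polyC.
  by set u := _ ^+ p; set v := _ ^+ b; set w := _ ^+ c; ring.
Qed.

Definition descent n (s : 'S_n.+1) (i : nat) : bool :=
  (s (inord i.+1) < s (inord i))%N.

Lemma des_sum n (s : 'S_n.+1) : des s = (\sum_(i < n) descent s i)%N.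
Proof.
rewrite /des cardsE -sum1_card big_mkcond big_ord_recr /= unfold_in.
case: existsP => [[j /andP[/eqP ej _]]|_].
  by have := ltn_ord j; rewrite ej ltnn.
rewrite addn0; apply: eq_bigr => i _; rewrite unfold_in /=.
have ei : widen_ord (leqnSn n) i = inord i.
  by apply: val_inj; rewrite /= inordK // ltnS ltnW.
have -> : [exists j : 'I_n.+1, (j == i.+1 :> nat) &&
    (s j < s (widen_ord (leqnSn n) i))%N] = descent s i.
  rewrite /descent -ei; apply/existsP/idP => [[j /andP[/eqP ej h]]|h].
    by have <- : j = inord i.+1 by apply: val_inj; rewrite /= inordK // ltnS.
  by exists (inord i.+1); rewrite h inordK ?eqxx // ltnS.
by case: descent.
Qed.

Lemma pk_sum n (s : 'S_n.+1) : pk s = (\sum_(i < n) peak (descent s) i)%N.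
Proof.
rewrite /pk cardsE -sum1_card big_mkcond big_ord_recr /= unfold_in.
case: existsP => [[h /existsP[j /and4P[_ /eqP ej _ _]]]|_].
  by have := ltn_ord j; rewrite ej ltnn.
rewrite addn0; apply: eq_bigr => i _; rewrite unfold_in /=.
have ei : widen_ord (leqnSn n) i = inord i.
  by apply: val_inj; rewrite /= inordK // ltnS ltnW.
set e := [exists h, _]; have -> : e = peak (descent s) i; last by case: peak.
rewrite /e /peak /descent -ei; apply/existsP/and3P.
  move=> [h /existsP[j /and4P[/eqP eh /eqP ej h1 h2]]].
  have -> : inord i.+1 = j by apply: val_inj; rewrite /= inordK // ltnS.
  have -> : inord i.-1 = h.
    by apply: val_inj; rewrite /= eh /= inordK.
  have eh' : nat_of_ord i = h.+1 := eh.
  split=> //; first by rewrite eh'.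
  by rewrite prednK ?eh' // -eh' -ei -leqNgt ltnW.
move=> [i0 nd d]; exists (inord i.-1); apply/existsP; exists (inord i.+1).
rewrite !inordK ?ltnS //=; last by rewrite (leq_trans (leq_pred _)) // ltnW.
rewrite prednK // eqxx d !andbT /=.
move: nd; rewrite prednK // -ei -leqNgt leq_eqVlt => /orP[/eqP/val_inj/perm_inj e1|//].
have := congr1 (@nat_of_ord _) e1.
rewrite /= inordK ?ltnS; last by rewrite (leq_trans (leq_pred _)) // ltnW.
move: i0; case: (nat_of_ord i) => //= k _ /eqP.
by rewrite -[X in X == _]addn0 -addn1 eqn_add2l.
by move=> ->; rewrite eqxx.
Qed.

Definition compatible n m (s : 'S_n) (a : {ffun 'I_n -> 'I_m}) : bool :=
  [forall i : 'I_n, forall j : 'I_n, (i < j)%N ==> letter_step (s j < s i)%N (a i) (a j)].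

(** Comparing neighbours is enough: along a block of equal letters, all steps of
  s go in the same direction. *)
Lemma compatible_chain n m (s : 'S_n.+1) (a : {ffun 'I_n.+1 -> 'I_m}) :
  compatible s a = chain (descent s) a.
Proof.
apply/forallP/forallP => [h j | h i].
  have /forallP/(_ (lift ord0 j)) := h (widen_ord (leqnSn n) j).
  rewrite /= /bump add1n ltnSn /= /descent.
  have -> : inord j.+1 = lift ord0 j by apply: val_inj; rewrite /= inordK // ltnS.
  have -> // : inord j = widen_ord (leqnSn n) j.
  by apply: val_inj; rewrite /= inordK // ltnS ltnW.
apply/forallP=> j; apply/implyP; move: {2}(j : nat) (erefl (j : nat)) => k ek.
elim: k j ek => [|k IH] j ek lij; first by rewrite ek in lij.
have ltkn : (k < n)%N by rewrite -ltnS -ek ltn_ord.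
have := h (Ordinal ltkn); rewrite /descent.
set w := widen_ord _ _.
have -> : inord (Ordinal ltkn).+1 = j.
  by apply: val_inj; rewrite /= inordK // ltnS.
have -> : inord (Ordinal ltkn) = w.
  by apply: val_inj; rewrite /= inordK // ltnS ltnW.
have -> : lift ord0 (Ordinal ltkn) = j by apply: val_inj; exact: esym ek.
move: (lij); rewrite ek ltnS leq_eqVlt => /orP[/eqP eik | ltik].
  by have -> : w = i by apply: val_inj.
have := IH w erefl ltik; rewrite /letter_step.
have nji : s j != s i by rewrite (inj_eq perm_inj) neq_ltn lij orbT.
have nwi : s w != s i by rewrite (inj_eq perm_inj) neq_ltn ltik orbT.
have njw : s j != s w.
  rewrite (inj_eq perm_inj); apply/eqP => /(congr1 (@nat_of_ord _)).
  by rewrite ek /= => /eqP; rewrite eqn_leq ltnn.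
rewrite -!val_eqE /= in nji nwi njw *.
case/orP=> [l1 | /andP[/eqP e1 b1]]; case/orP=> [l2 | /andP[/eqP e2 b2]].
- by rewrite (ltn_trans l1 l2).
- by rewrite -e2 l1.
- by rewrite e1 l2.
apply/orP; right; rewrite e1 e2 eqxx /= -e2 -e1.
move: b1 b2; rewrite -e1; case: (barred _) => /eqP b1 /eqP b2; apply/eqP; lia.
Qed.

Definition compat_sum (R : comNzRingType) (y : R) n (s : 'S_n) (k : nat) : R :=
  \sum_(a : {ffun 'I_n -> 'I_(k.*2)} | compatible s a) weight y a.

Definition pkdes_poly (R : comNzRingType) (y : R) n (s : 'S_n) : {poly R} :=
  (1 + y)%:P * ((1 + y) ^+ 2 *: 'X) ^+ pk s * (y%:P + 'X) ^+ (des s - pk s)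
    * (1 + y *: 'X) ^+ (n.-1 - des s - pk s) * 'X.

Lemma pk_le_des n (s : 'S_n.+1) : (pk s <= des s)%N.
Proof.
rewrite pk_sum des_sum.
by have [] := total_polyE (1 : int) (descent s) n.
Qed.

Lemma des_add_pk n (s : 'S_n.+1) : (des s + pk s <= n)%N.
Proof.
rewrite pk_sum des_sum.
by have [] := total_polyE (1 : int) (descent s) n.
Qed.

(** The statistics (pk, des) of s are read off the numerator of the series that
  counts the words compatible with s. *)
Lemma compat_sum_series (R : comNzRingType) (y : R) n (s : 'S_n.+1) :
  series_of n.+2 (pkdes_poly y s) (compat_sum y s).
Proof.
have [hu hv] := last_letter_series y (descent s) n.
have := level_sum_series (series_ofD hu hv).
rewrite /pkdes_poly des_sum pk_sum /=.
have [_ _ ->] := total_polyE y (descent s) n; apply: series_of_ext => k.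
rewrite /level_sum -chain_sum; apply: eq_bigl => a.
by rewrite compatible_chain.
Qed.

(** * Sorting words, and the Eulerian polynomials *)

Lemma perm_val_card n (s : 'S_n) p : nat_of_ord (s p) = (\sum_(q | s q < s p) 1)%N.
Proof.
transitivity (\sum_(i < n | i < s p) 1)%N; last by rewrite (reindex_inj (@perm_inj _ s)).
rewrite -(big_ord_widen_cond n xpredT (fun=> 1%N) (ltnW (ltn_ord (s p)))).
by rewrite sum1_card card_ord.
Qed.

(** The implication in one direction is enough because both sides are strict
  total orders: a permutation is determined by the order it induces. *)
Lemma sorting_perm_unique n (Y : 'I_n -> nat) : injective Y ->
  exists t : 'S_n, forall s : 'S_n,
    (forall p q, (s p < s q)%N -> (Y p < Y q)%N) <-> s = t.
Proof.
move=> injY; pose r p := #|[set q | Y q < Y p]%N|.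
have rlt p : (r p < n)%N.
  rewrite -[X in (_ < X)%N]card_ord -cardsT; apply: proper_card.
  by apply/properP; split; [apply: subsetT | exists p; rewrite !inE ?ltnn].
have rmono p q : (Y p < Y q)%N -> (r p < r q)%N.
  move=> lpq; apply: proper_card; apply/properP; split.
    by apply/subsetP => x; rewrite !inE => /ltn_trans ->.
  by exists p; rewrite !inE ?ltnn.
have rmonoE p q : (r p < r q)%N = (Y p < Y q)%N.
  case: (ltngtP (Y p) (Y q)) => [/rmono //| /rmono | /injY ->]; last by rewrite ltnn.
  by case: ltngtP.
have injr : injective (fun p => Ordinal (rlt p)).
  move=> p q /(congr1 val) /= e; apply: injY; apply/eqP.
  by rewrite eqn_leq ![(Y _ <= _)%N]leqNgt -!rmonoE e ltnn.
exists (perm injr) => s; split=> [hs | ->]; last first.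
  by move=> p q; rewrite !permE /= rmonoE.
have hsE p q : (s p < s q)%N = (Y p < Y q)%N.
  apply/idP/idP => [/hs //|].
  case: (ltngtP (s p) (s q)) => // [/hs|/val_inj/perm_inj ->]; last by rewrite ltnn.
  by case: ltngtP.
apply/permP => p; apply: val_inj.
transitivity (\sum_(q | s q < s p) 1)%N; first exact: perm_val_card.
rewrite -[RHS]/(nat_of_ord (perm injr p)) [RHS]perm_val_card.
by apply: eq_bigl => q; rewrite hsE !permE /= rmonoE.
Qed.

Lemma perm_order_inj n (s t : 'S_n) :
  (forall p q, (s p < s q)%N = (t p < t q)%N) -> s = t.
Proof.
move=> h; have inj : injective (fun p => nat_of_ord (t p)).
  by move=> p q /val_inj/perm_inj.
have [u hu] := sorting_perm_unique inj.
have /hu -> : forall p q, (s p < s q)%N -> (t p < t q)%N by move=> p q; rewrite h.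
by symmetry; apply/hu.
Qed.

Lemma letters_sum (R : comNzRingType) (y : R) k :
  \sum_(x < k.*2) y ^+ barred x = k%:R * (1 + y).
Proof.
elim: k => [|k IH]; first by rewrite big_ord0 mul0r.
rewrite doubleS !big_ord_recr /= IH /barred /= odd_double /= -[k.+1]addn1 natrD.
by rewrite expr0 expr1 mulrDl mul1r -addrA [y + 1]addrC.
Qed.

Lemma words_sum (R : comNzRingType) (y : R) n k :
  \sum_(w : {ffun 'I_n -> 'I_(k.*2)}) weight y w = (k%:R * (1 + y)) ^+ n.
Proof.
rewrite -letters_sum -[X in _ ^+ X]card_ord -prodr_const.
by rewrite (bigA_distr_bigA (fun (i : 'I_n) (x : 'I_(k.*2)) => y ^+ barred x)).
Qed.

Lemma weight_perm (R : comNzRingType) (y : R) n m (s : 'S_n) (w : {ffun 'I_n -> 'I_m}) :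
  weight y [ffun i => w (s i)] = weight y w.
Proof.
rewrite /weight [RHS](reindex_inj (@perm_inj _ s)) /=.
by apply: eq_bigr => i _; rewrite ffunE.
Qed.

(** Rearranging the letters of a word does not change its weight; the words are
  then indexed by points moved by t instead of by positions. *)
Lemma compat_sum_conj (R : comNzRingType) (y : R) n (s t : 'S_n) k :
  compat_sum y s k =
  \sum_(w : {ffun 'I_n -> 'I_(k.*2)} | compatible s [ffun i => w (t i)]) weight y w.
Proof.
rewrite /compat_sum.
have bij : bijective (fun w : {ffun 'I_n -> 'I_(k.*2)} => [ffun i => w (t i)]).
  exists (fun w : {ffun 'I_n -> 'I_(k.*2)} => [ffun i => w ((t^-1)%g i)]) => w;
    by apply/ffunP => i; rewrite !ffunE ?permK ?permKV.
rewrite (reindex _ (onW_bij _ bij)) /=.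
by apply: eq_bigr => w _; rewrite weight_perm.
Qed.

(** Every word is sorted into a compatible one by exactly one permutation: equal
  plain letters keep their order, equal barred letters are reversed. *)
Lemma compat_sum_all (R : comNzRingType) (y : R) n k :
  \sum_(s : 'S_n) compat_sum y s k = (k%:R * (1 + y)) ^+ n.
Proof.
rewrite -words_sum.
rewrite (eq_bigr _ (fun s _ => compat_sum_conj y s s k)).
rewrite (exchange_big_dep xpredT) //=; apply: eq_bigr => w _.
(* lexicographic order on (letter, position), with positions reversed under a bar *)
pose Y (p : 'I_n) := (w p * n + (if barred (w p) then n.-1 - p else p))%N.
have Ylt (p q : 'I_n) : p != q -> letter_step (q < p)%N (w p) (w q) = (Y p < Y q)%N.
  rewrite -val_eqE /= => npq; have hp := ltn_ord p; have hq := ltn_ord q.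
  have rp b : ((if b : bool then n.-1 - p else p) < n)%N by case: b; lia.
  have rq b : ((if b : bool then n.-1 - q else q) < n)%N by case: b; lia.
  rewrite /letter_step /Y.
  case: (ltngtP (w p) (w q)) => /= [lt|gt|->].
  - have := rp (barred (w p)); nia.
  - have := rq (barred (w q)); nia.
  - rewrite ltn_add2l; case: barred; lia.
have injY : injective Y.
  move=> p q e; apply/eqP; apply: contraT => npq.
  have := Ylt _ _ npq; rewrite eq_sym in npq; have := Ylt _ _ npq.
  rewrite e ltnn /letter_step => h1 h2.
  rewrite -val_eqE /= in npq.
  move: h1 h2 npq; case: (ltngtP (w p) (w q)) => //= ->.
  by case: (ltngtP p q) => //; case: barred.
have [t ht] := sorting_perm_unique injY.
rewrite (big_pred1 (t^-1)%g) // => s; apply/idP/eqP.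
  move=> /forallP h; rewrite -[s]invgK; congr (_^-1)%g; apply/ht => p q lpq.
  have npq : p != q by apply: contraTneq lpq => ->; rewrite ltnn.
  have /forallP/(_ ((s^-1)%g q))/implyP/(_ lpq) := h ((s^-1)%g p).
  by rewrite !ffunE !permKV Ylt.
move=> es; have [_ /(_ erefl) h] := ht t.
apply/forallP => i; apply/forallP => j; apply/implyP => lij.
rewrite !ffunE Ylt; last first.
  by rewrite (inj_eq perm_inj); apply: contraTneq lij => ->; rewrite ltnn.
by apply: h; rewrite es !permKV.
Qed.

Lemma pkdes_poly0 (R : comNzRingType) n (s : 'S_n.+1) :
  pkdes_poly (0 : R) s = 'X ^+ (des s).+1.
Proof.
rewrite /pkdes_poly !addr0 !scale0r addr0 !expr1n scale1r mulr1 mul1r add0r.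
by rewrite -exprD subnKC ?pk_le_des // exprSr.
Qed.

(** Carlitz's identity, as the case y = 0 of [compat_sum_series] and
  [compat_sum_all]: barred letters disappear, and only des is left in the
  numerator. *)
Lemma eulerian_series (R : comNzRingType) n :
  series_of n.+2 (eulerian n.+1 ('X : {poly R})) (fun k => k%:R ^+ n.+1).
Proof.
have := series_of_sum (r := index_enum 'S_n.+1) xpredT
  (fun s _ => compat_sum_series (0 : R) s).
rewrite (eq_bigr _ (fun s _ => pkdes_poly0 R s)); apply: series_of_ext => k.
by rewrite compat_sum_all addr0 mulr1.
Qed.

(** * Cyclic permutations as conjugates of the shift *)

Definition cyclic_shift n : 'S_n.+1 := perm (can_inj (@ordSK n.+1)).

Lemma cyclic_shiftX n p (i : 'I_n.+1) :
  ((cyclic_shift n ^+ p)%g i : nat) = ((i + p) %% n.+1)%N.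
Proof.
elim: p => [|p IH]; first by rewrite expg0 perm1 addn0 modn_small.
by rewrite expgSr permM permE /= IH -addn1 modnDml addn1 addnS.
Qed.

(** The cycle of c^s, read from s 0, is the sequence of values of s.  So s is
  determined by c^s and s 0. *)
Lemma conj_shiftX n (s : 'S_n.+1) (p : 'I_n.+1) :
  (((cyclic_shift n ^ s) ^+ p)%g (s ord0)) = s p.
Proof.
rewrite -conjXg permJ; congr (s _); apply: val_inj.
by rewrite /= -[LHS]/(nat_of_ord _) cyclic_shiftX add0n modn_small.
Qed.

Lemma cyclic_permP n (s : 'S_n.+1) i :
  reflect (porbit s i = setT) (cyclic_perm s).
Proof.
apply: (iffP cards1P) => [[A eA] | ei].
  apply/setP => j; rewrite inE.
  have : porbit s i \in porbits s by exact: imset_f.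
  rewrite eA inE => /eqP ->.
  have : porbit s j \in porbits s by exact: imset_f.
  rewrite eA inE => /eqP <-.
  exact: porbit_id.
exists setT; apply/setP => A; rewrite inE; apply/imsetP/eqP => [[j _ ->] | ->].
  by rewrite -ei; apply/eqP; rewrite eq_porbit_mem ei.
by exists i; rewrite ?ei.
Qed.

Lemma cyclic_perm_conj n (s : 'S_n.+1) : cyclic_perm (cyclic_shift n ^ s)%g.
Proof.
apply/(cyclic_permP _ (s ord0))/setP => j; rewrite inE.
by rewrite -[j](permKV s) -(conj_shiftX s (s^-1 j)%g) mem_porbit.
Qed.

Lemma cyclic_perm_is_conj n (s : 'S_n.+1) i : cyclic_perm s ->
  exists2 t : 'S_n.+1, (cyclic_shift n ^ t)%g = s & t ord0 = i.
Proof.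
move=> /(cyclic_permP _ i) orbT.
have card_orb : #|porbit s i| = n.+1 by rewrite orbT cardsT card_ord.
have inj : injective (fun p : 'I_n.+1 => iter p s i).
  move=> p q e; apply: val_inj; apply/eqP.
  have := uniq_traject_porbit s i; rewrite card_orb => /(nth_uniq i) <-.
  - by rewrite (nth_traject _ (ltn_ord p)) (nth_traject _ (ltn_ord q)); apply/eqP/e.
  - by rewrite size_traject ltn_ord.
  - by rewrite size_traject ltn_ord.
exists (perm inj); last by rewrite permE.
apply/permP => x; rewrite -[x](permKV (perm inj)) permJ.
set p := ((perm inj)^-1)%g x; rewrite !permE /= -[RHS]/(iter p.+1 s i).
case: (ltngtP p n) => [ltpn | | epn]; first by rewrite modn_small.
  by rewrite ltnNge -ltnS ltn_ord.
by rewrite epn modnn; have := iter_porbit s i; rewrite card_orb => ->.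
Qed.

(** A preimage of a cyclic permutation under conjugation of the shift amounts to
  the choice of a starting point on its cycle. *)
Lemma sum_conj_shift (R : comNzRingType) n (f : 'S_n.+1 -> R) :
  \sum_(s : 'S_n.+1) f (cyclic_shift n ^ s)%g
  = n.+1%:R * \sum_(s : 'S_n.+1 | cyclic_perm s) f s.
Proof.
pose h (s : 'S_n.+1) := ((cyclic_shift n ^ s)%g, s ord0).
(* injh makes the default value irrelevant on the image of h *)
pose h' (x : 'S_n.+1 * 'I_n.+1) := odflt 1%g [pick t | h t == x].
have injh s t : h s = h t -> s = t.
  move=> [e1 e2]; apply/permP => p.
  by rewrite -(conj_shiftX s p) -(conj_shiftX t p) e1 e2.
have hK s : h' (h s) = s.
  rewrite /h'; case: pickP => [t /eqP/injh //|/(_ s)]; by rewrite eqxx.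
transitivity (\sum_(x : 'S_n.+1 * 'I_n.+1 | cyclic_perm x.1) f x.1).
  rewrite (reindex_onto h h') /=.
    by apply: eq_bigl => s; rewrite cyclic_perm_conj hK eqxx.
  move=> [s i] /= cs; have [t e1 e2] := cyclic_perm_is_conj i cs.
  have -> : (s, i) = h t by rewrite /h e1 e2.
  by rewrite hK.
transitivity (\sum_(s : 'S_n.+1 | cyclic_perm s) \sum_(i < n.+1) f s).
  by rewrite pair_big /=; apply: eq_bigl => x; rewrite andbT.
by rewrite mulr_sumr; apply: eq_bigr => s _; rewrite sumr_const card_ord mulr_natl.
Qed.

(** * The Moebius function *)

Lemma mobius_prime_mul p d : prime p -> (0 < d)%N ->
  mobius (p * d) = if (p %| d)%N then 0 else - mobius d.
Proof.
move=> pr d0; have p0 := prime_gt0 pr.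
case: ifP => [pd | /negbT npd]; rewrite /mobius muln_gt0 p0 d0 /=.
  case: allP => // h; have := h p.
  rewrite mem_primes pr muln_gt0 p0 d0 dvdn_mulr //= => /(_ isT).
  by rewrite lognM // logn_prime // eqxx add1n eqSS lognE pr d0 pd.
have pnd : p \notin primes d by rewrite mem_primes pr d0 (negPf npd).
have eprimes : perm_eq (primes (p * d)) (p :: primes d).
  apply: uniq_perm; rewrite /= ?primes_uniq ?pnd // => q.
  by rewrite primesM // primes_prime // !inE.
rewrite (perm_all _ eprimes) (perm_size eprimes) /= lognM // logn_prime // eqxx.
rewrite (lognE p d) pr d0 (negPf npd) addn0 eqxx /=.
rewrite (eq_in_all (a2 := fun q => logn q d == 1%N)); last first.
  move=> q qd; rewrite lognM // logn_prime //.
  by case: (eqVneq q p) => [eqp|//]; rewrite -eqp qd in pnd.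
by case: all; rewrite ?oppr0 // exprS mulN1r.
Qed.

(** Let p be the smallest prime factor of n.  Multiplication by p changes the sign
  of the Moebius function, and maps the divisors prime to p onto those divisible
  by p but not by p^2; on the multiples of p^2 the function vanishes. *)
Lemma mobius_sum n : (0 < n)%N -> \sum_(d <- divisors n) mobius d = (n == 1%N)%:R.
Proof.
move=> n0; case: eqP => [-> | /eqP n1]; first by rewrite big_seq1.
have pr : prime (pdiv n) by apply: pdiv_prime; case: n n0 n1 => [|[]].
set p := pdiv n in pr; have pn : (p %| n)%N := pdiv_dvd n.
have p0 := prime_gt0 pr.
have np0 : (0 < n %/ p)%N by rewrite divn_gt0 // dvdn_leq.
rewrite (bigID (fun d => p %| d)%N) /=.
set A := \sum_(d <- divisors n | (p %| d)%N) _.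
suff -> : A = - \sum_(d <- divisors n | ~~ (p %| d)%N) mobius d by rewrite addNr.
rewrite /A.
have step : perm_eq [seq d <- divisors n | (p %| d)%N]
                    [seq (p * d)%N | d <- divisors (n %/ p)].
  apply: uniq_perm; rewrite ?filter_uniq ?divisors_uniq //.
    rewrite map_inj_in_uniq ?divisors_uniq // => x y _ _ /eqP.
    by rewrite eqn_pmul2l // => /eqP.
  move=> d; rewrite mem_filter -dvdn_divisors //; apply/andP/mapP.
    move=> [/dvdnP[k ->] kn]; exists k; last by rewrite mulnC.
    by rewrite -dvdn_divisors // dvdn_divRL.
  move=> [k]; rewrite -dvdn_divisors // => kn ->.
  by rewrite dvdn_mulr //; split=> //; rewrite mulnC -dvdn_divRL.
rewrite -big_filter (perm_big _ step) big_map -[in RHS]big_filter.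
rewrite -sumrN (bigID (fun d => p %| d)%N) /= big1_seq ?add0r; last first.
  move=> d /andP[pd]; rewrite -dvdn_divisors // => dn.
  by rewrite mobius_prime_mul ?pd // (dvdn_gt0 np0).
have step2 : perm_eq [seq d <- divisors (n %/ p) | ~~ (p %| d)%N]
                    [seq d <- divisors n | ~~ (p %| d)%N].
  apply: uniq_perm; rewrite ?filter_uniq ?divisors_uniq // => d.
  rewrite !mem_filter -!dvdn_divisors //; case: (boolP (p %| d)%N) => //= npd.
  rewrite dvdn_divRL // Gauss_dvd ?pn ?andbT //.
  by rewrite coprime_sym prime_coprime.
rewrite -big_filter (perm_big _ step2) !big_filter.
rewrite big_seq_cond [RHS]big_seq_cond; apply: eq_bigr => d /andP[].
rewrite -dvdn_divisors // => dn npd.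
by rewrite mobius_prime_mul ?(negPf npd) // (dvdn_gt0 n0 dn).
Qed.

(** For b odd, (-1)^(e/d) is -1 plus twice the indicator that e/d is even, so that
  the sum reduces to two sums of the Moebius function, over the divisors of e and of
  e/2. *)
Lemma mobius_sign_sum e (b : bool) : (0 < e)%N ->
  \sum_(d <- divisors e) mobius d * (-1) ^+ (b * (e %/ d + e))%N
  = ((e == 1%N) + ((e == 2%N) && b).*2)%:R.
Proof.
move=> e0; case: b; last first.
  rewrite andbF addn0 -mobius_sum //; apply: eq_bigr => d _.
  by rewrite mul0n mulr1.
have sgn x : (-1) ^+ x = -1 + (~~ odd x).*2%:R :> int.
  by rewrite -signr_odd; case: odd.
rewrite andbT (eq_bigr (fun d => (-1) ^+ e *
   (- mobius d + (if ~~ odd (e %/ d) then mobius d *+ 2 else 0)))); last first.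
  move=> d _; rewrite mul1n addnC exprD mulrCA; congr (_ * _); rewrite sgn.
  by rewrite mulrDr mulrN1 mulr_natr; case: odd.
rewrite -mulr_sumr big_split /= sumrN mobius_sum // -big_mkcond /= sumrMnl.
have -> : \sum_(d <- divisors e | ~~ odd (e %/ d)) mobius d = (e == 2%N)%:R.
  case: (boolP (odd e)) => [oe | ne].
    rewrite big_seq_cond big1 => [|d /andP[]].
      by case: eqP oe => [->|].
    rewrite -dvdn_divisors // => de; rewrite -(divnK de) oddM in oe.
    by case/andP: oe => ->.
  have e2 : e = (2 * e./2)%N by rewrite mul2n -[LHS]odd_double_half (negPf ne).
  have h0 : (0 < e./2)%N by rewrite half_gt0; case: e e0 ne {e2} => [|[]].
  have st : perm_eq [seq d <- divisors e | ~~ odd (e %/ d)] (divisors e./2).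
    apply: uniq_perm; rewrite ?filter_uniq ?divisors_uniq // => d.
    rewrite mem_filter -!dvdn_divisors //; apply/andP/idP => [[od de]|dh].
      rewrite -(dvdn_pmul2l (isT : 0 < 2)%N) -e2 -(divnK de) dvdn_pmul2r ?dvdn2 //.
      exact: dvdn_gt0 de.
    split; last by rewrite e2 dvdn_mull.
    by rewrite e2 -muln_divA // oddM.
  rewrite -big_filter (perm_big _ st) mobius_sum //.
  by rewrite [in RHS]e2 -[X in _ = (_ == X)%:R](muln1 2%N) eqn_pmul2l.
case: (eqVneq e 1%N) => [->|n1]; first by [].
by case: (eqVneq e 2%N) => [->|n2] //; rewrite mul0rn oppr0 addr0 mulr0.
Qed.

(** * Ranking the rotations of a periodic word *)

(** A word of length N = re is seen as the N-periodic sequence f, and r is its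
  least period.  Rotations are the sequences starting at each position p. *)
Section SignedLexOrder.

Variables (N r e : nat) (f : nat -> nat).
Hypotheses (r_gt0 : (0 < r)%N) (e_gt0 : (0 < e)%N) (N_eq : N = (r * e)%N).
Hypothesis f_per : forall p, f (p + r) = f p.
Hypothesis r_min : forall l, (forall p, f (p + l) = f p) -> (r %| l)%N.

(** The parity of the number of bars among the j letters from p on, that is,
  whether comparing after these letters reverses the order. *)
Fixpoint flips p j : bool :=
  if j is i.+1 then flips p i (+) barred (f (p + i)) else false.

Lemma flipsD p i j : flips p (i + j) = flips p i (+) flips (p + i) j.
Proof.
elim: j => [|j IH]; first by rewrite addn0 /= addbF.
by rewrite addnS /= IH addbA addnA.
Qed.

Lemma f_perM p x : f (p + x * r) = f p.
Proof. by elim: x => [|x IH]; rewrite ?addn0 // mulSnr addnA f_per. Qed.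

Lemma flips_shift p x j : flips (p + x * r) j = flips p j.
Proof. by elim: j => //= j ->; rewrite addnAC f_perM. Qed.

Lemma flips_period p : flips p r = flips 0 r.
Proof.
have h : flips 0 (p + r) = flips 0 p (+) flips 0 r.
  by rewrite addnC flipsD -[X in flips (0 + X) p]mul1n flips_shift addbC.
by move: h; rewrite flipsD => /addbI.
Qed.

Lemma f_modN p q : p = q %[mod N] -> f p = f q.
Proof.
move=> e1; rewrite (divn_eq p N) (divn_eq q N) e1 N_eq.
by rewrite ![(_ * (r * e))%N]mulnCA ![(r * _)%N]mulnC ![(_ * r + _)%N]addnC !f_perM.
Qed.

Lemma tied_mod p q :
  (forall i, (i < N)%N -> f (p + i) = f (q + i)) -> p = q %[mod r].
Proof.
move=> tie.
have N0 : (0 < N)%N by rewrite N_eq muln_gt0 r_gt0.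
have tie' i : f (p + i) = f (q + i).
  have := tie (i %% N)%N (ltn_pmod _ N0).
  rewrite (@f_modN (p + i %% N) (p + i)) ?modnDmr //.
  by rewrite (@f_modN (q + i %% N) (q + i)) ?modnDmr.
wlog lpq : p q tie' {tie} / (p <= q)%N.
  move=> h; case/orP: (leq_total p q) => ?; first exact: h.
  by symmetry; apply: h => // i; rewrite tie'.
apply/eqP; rewrite eq_sym eqn_mod_dvd //; apply: r_min => x.
rewrite -(f_perM (x + (q - p)) p) -(f_perM x p).
have e0 : (p * r = p + p * r.-1)%N by rewrite -mulnS prednK.
have -> : (x + (q - p) + p * r = q + (x + p * r.-1))%N by rewrite e0; lia.
have -> : (x + p * r = p + (x + p * r.-1))%N by rewrite e0; lia.
by rewrite tie'.
Qed.

(** The values of s rank the N rotations for the signed lexicographic order; ties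
  may be broken in any way that is consistent with removing first letters. *)
Definition rotation_ranking (s : nat -> nat) : Prop :=
  (forall p q, s p = s q <-> p = q %[mod N]) /\
  (forall p q, (s p < s q)%N -> letter_step (s q.+1 < s p.+1)%N (f p) (f q)).

Lemma ranking_step s p q : rotation_ranking s -> p <> q %[mod N] -> f p = f q ->
  (s p < s q)%N = (s p.+1 < s q.+1)%N (+) barred (f p).
Proof.
move=> [sN sV] npq fpq.
have nS : s p.+1 <> s q.+1.
  move/sN => h; apply: npq; apply/eqP; rewrite -(eqn_modDr 1) !addn1.
  exact/eqP.
have ns : s p <> s q by move/sN.
move: (sV p q) (sV q p); rewrite /letter_step fpq ltnn eqxx /=.
case: (ltngtP (s p) (s q)) ns => // h _ => [/(_ isT) /eqP <- _ | _ /(_ isT) /eqP <-].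
  by case: (ltngtP (s p.+1) (s q.+1)) nS.
by case: (ltngtP (s p.+1) (s q.+1)) nS.
Qed.

Lemma neq_modN_D p q i : p <> q %[mod N] -> p + i <> q + i %[mod N].
Proof. by move=> h /eqP; rewrite eqn_modDr => /eqP. Qed.

Lemma ranking_iter s p q j : rotation_ranking s -> p <> q %[mod N] ->
  (forall i, (i < j)%N -> f (p + i) = f (q + i)) ->
  (s p < s q)%N = (s (p + j) < s (q + j))%N (+) flips p j.
Proof.
move=> sc npq; elim: j => [|j IH] tie; first by rewrite !addn0 addbF.
rewrite IH; last by move=> i lij; apply: tie; rewrite ltnW.
rewrite (ranking_step sc (neq_modN_D (i := j) npq)) ?tie // !addnS /=.
by rewrite tie // -addbA [barred _ (+) _]addbC.
Qed.

Lemma ranking_cmp s p q j : rotation_ranking s ->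
  (forall i, (i < j)%N -> f (p + i) = f (q + i)) -> f (p + j) <> f (q + j) ->
  (s p < s q)%N = (f (p + j) < f (q + j))%N (+) flips p j.
Proof.
move=> sc tie nf.
have npq : p <> q %[mod N].
  move=> h; apply: nf; apply: f_modN; apply/eqP; rewrite eqn_modDr; exact/eqP.
rewrite (ranking_iter sc npq tie); congr (_ (+) _).
have [sN sV] := sc; move: (sV (p + j) (q + j)) (sV (q + j) (p + j)).
rewrite /letter_step.
have ns : s (p + j) <> s (q + j) by move/sN/neq_modN_D; apply; apply: npq.
case: (ltngtP (s (p + j)) (s (q + j))) ns => // _ _;
  case: (ltngtP (f (p + j)) (f (q + j))) nf => //=.
  by move=> _ _ /(_ isT).
by move=> _ _ _ /(_ isT).
Qed.

(** If g 0 < g k, then the values g (xk) increase with x, although they come back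
  to g 0 at x = e; likewise if g k < g 0. *)
Lemma shift_monotone_dvd (g : nat -> nat) k :
  (forall x y, g x = g y <-> x = y %[mod e]) ->
  (forall x y, (g x < g y)%N -> (g (x + k) < g (y + k))%N) -> (e %| k)%N.
Proof.
move=> gE gk.
have up : ~ (g 0 < g k)%N.
  move=> h; have inc x : (g 0 < g (x.+1 * k))%N.
    suff h' y : (g (y * k) < g (y.+1 * k))%N.
      by elim: x => [|x IH]; [rewrite mul1n | apply: ltn_trans IH (h' _)].
    by elim: y => [|y IH]; rewrite ?mul1n // mulSnr [(y.+2 * k)%N]mulSnr gk.
  have := inc e.-1; rewrite prednK // (_ : g (e * k)%N = g 0) ?ltnn //.
  by apply/gE; rewrite modnMr mod0n.
have down : ~ (g k < g 0)%N.
  move=> h; have dec x : (g (x.+1 * k) < g 0)%N.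
    suff h' y : (g (y.+1 * k) < g (y * k))%N.
      by elim: x => [|x IH]; [rewrite mul1n | apply: ltn_trans (h' _) IH].
    by elim: y => [|y IH]; rewrite ?mul1n // [(y.+1 * k)%N]mulSnr [(y.+2 * k)%N]mulSnr gk.
  have := dec e.-1; rewrite prednK // (_ : g (e * k)%N = g 0) ?ltnn //.
  by apply/gE; rewrite modnMr mod0n.
have : g k = g 0 by case: ltngtP up down.
by move/gE/eqP; rewrite mod0n.
Qed.

(** The e positions that are multiples of r start equal rotations.  The shift by
  r preserves or reverses the order of their ranks, so the shift by 2r preserves
  it, and a cyclic shift that preserves a total order is trivial. *)
Lemma ranking_exponent s : rotation_ranking s -> e = 1%N \/ e = 2%N /\ flips 0 r.
Proof.
move=> sc; have [sN sV] := sc; pose g x := s (x * r)%N.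
have gE x y : g x = g y <-> x = y %[mod e].
  rewrite sN N_eq ![(_ * r)%N]mulnC -!muln_modr.
  by split=> [/eqP|->//]; rewrite eqn_pmul2l // => /eqP.
have gS x y : (g x < g y)%N -> (g (x + 1) < g (y + 1))%N = ~~ flips 0 r.
  move=> lt; have npq : (x * r) <> (y * r) %[mod N].
    by move/sN => h; rewrite /g h ltnn in lt.
  have tie i : (i < r)%N -> f (x * r + i) = f (y * r + i).
    by move=> _; rewrite ![(_ * r + i)%N]addnC !f_perM.
  move: lt; rewrite /g (ranking_iter sc npq tie) flips_period !mulnDl mul1n.
  by case: flips; case: ltnP.
have e2 : (e %| 2)%N.
  apply: (shift_monotone_dvd gE) => x y lt.
  have npq : ~ g (x + 1) = g (y + 1).
    move/gE/eqP; rewrite eqn_modDr => /eqP/gE h; by rewrite h ltnn in lt.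
  have := gS _ _ lt; case: (ltngtP (g (x + 1)) (g (y + 1))) npq => // h _ fl.
    by rewrite -[2%N]/(1 + 1)%N !addnA gS.
  have := gS _ _ h; rewrite -fl; rewrite -!addnA => /negbT.
  rewrite -leqNgt leq_eqVlt => /orP[/eqP/gE/eqP|//].
  by rewrite eqn_modDr => /eqP/gE h'; rewrite h' ltnn in lt.
case: (boolP (flips 0 r)) => fl; last first.
  left; apply/eqP; rewrite -dvdn1; apply: (shift_monotone_dvd gE) => x y lt.
  by rewrite gS.
by case: e e_gt0 e2 => [|[|[|]]] //; [left | right].
Qed.

Lemma half_period p q : e = 2%N -> p <> q %[mod N] -> p = q %[mod r] ->
  q = p + r %[mod N].
Proof.
move=> e2 npq pqr.
have modN x : x = odd (x %/ r) * r + x %% r %[mod N].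
  rewrite {1}(divn_eq x r) -{1}(odd_double_half (x %/ r)) -muln2 mulnDl -mulnA.
  by rewrite [(2 * r)%N]mulnC -e2 -N_eq addnAC addnC modnMDl.
rewrite [RHS](modN _); move: npq; rewrite !(modN p) !(modN q).
rewrite divnDr ?dvdnn // divnn r_gt0 modnDr pqr addn1 /=.
by case: odd; case: odd => // _; rewrite mul0n mul1n.
Qed.

(** Distinct rotations are compared at their first difference.  Equal ones occur
  only for e = 2, and the comparison of p and p + r is carried back to that of
  0 and r, which the hypothesis fixes. *)
Lemma ranking_unique s s' : rotation_ranking s -> rotation_ranking s' ->
  (e = 1%N \/ e = 2%N /\ (s 0 < s r)%N = (s' 0 < s' r)%N) ->
  forall p q, (s p < s q)%N = (s' p < s' q)%N.
Proof.
move=> sc sc' he p q; have [sN sV] := sc; have [sN' sV'] := sc'.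
case: (eqVneq (p %% N)%N (q %% N)%N) => [epq | /eqP npq].
  by rewrite (proj2 (sN p q) epq) (proj2 (sN' p q) epq) !ltnn.
case: (boolP [forall i : 'I_N, f (p + i) == f (q + i)]) => [/forallP tie | nt].
  have tie' i : (i < N)%N -> f (p + i) = f (q + i).
    by move=> h; apply/eqP; apply: (tie (Ordinal h)).
  have pqr := tied_mod tie'.
  case: he => [e1 | [e2 h0r]].
    by case: npq; rewrite N_eq e1 muln1.
  have eq_pr := half_period e2 npq pqr.
  have n0r : 0 <> r %[mod N].
    rewrite mod0n N_eq e2 modn_small; last by lia.
    by move=> h; move: (r_gt0); rewrite -h.
  have h s1 : rotation_ranking s1 -> (s1 p < s1 q)%N = (s1 0 < s1 r)%N (+) flips 0 p.
    move=> c1; have [c1N _] := c1.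
    rewrite (@ranking_iter s1 0 r p c1 n0r); last first.
      by move=> i _; rewrite add0n [(r + i)%N]addnC f_per.
    rewrite add0n [(r + p)%N]addnC (proj2 (c1N q (p + r)%N) eq_pr).
    by rewrite -addbA addbb addbF.
  by rewrite (h s) // (h s') // h0r.
have exj : exists j, f (p + j) != f (q + j).
  by move: nt; rewrite negb_forall => /existsP[j hj]; exists j.
case: (ex_minnP exj) => j /eqP nf jmin.
have tie i : (i < j)%N -> f (p + i) = f (q + i).
  by move=> lij; apply/eqP; apply: contraTT lij => /jmin; rewrite leqNgt.
by rewrite (ranking_cmp sc tie nf) (ranking_cmp sc' tie nf).
Qed.

Variable m : nat.
Hypothesis f_lt : forall p, (f p < m)%N.

(** The first j letters from p on, read as a numeral in base m in which a barred
  letter complements all later digits: the order of these numerals is the signed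
  lexicographic order on prefixes. *)
Fixpoint code j p : nat :=
  if j is i.+1 then
    (f p * m ^ i + (if barred (f p) then (m ^ i).-1 - code i p.+1 else code i p.+1))%N
  else 0%N.

Lemma code_lt j p : (code j p < m ^ j)%N.
Proof.
have m0 : (0 < m)%N := leq_ltn_trans (leq0n _) (f_lt 0).
elim: j p => [|j IH] p /=; first by rewrite expn0.
have mj : (0 < m ^ j)%N by rewrite expn_gt0 m0.
have := IH p.+1; have := f_lt p; rewrite expnS.
move: (m ^ j)%N (code j p.+1) mj => M c; case: barred; nia.
Qed.

Lemma code_cmp j p q : (code j.+1 p < code j.+1 q)%N =
  (f p < f q)%N || (f p == f q) &&
    (if barred (f p) then code j q.+1 < code j p.+1 else code j p.+1 < code j q.+1)%N.
Proof.
rewrite /=; have := code_lt j p.+1; have := code_lt j q.+1.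
move: (m ^ j)%N (code j p.+1) (code j q.+1) => M c d hd hc.
case: (ltngtP (f p) (f q)) => [lt | gt | ->] /=.
- by case: barred; case: barred; nia.
- by case: barred; case: barred; nia.
by rewrite ltn_add2l; case: barred; lia.
Qed.

Lemma code_eq j p q :
  code j.+1 p = code j.+1 q -> f p = f q /\ code j p.+1 = code j q.+1.
Proof.
move=> h; have := code_cmp j p q; have := code_cmp j q p; rewrite h ltnn.
case: (ltngtP (f p) (f q)) => //= ->.
by case: barred; case: ltngtP.
Qed.

Lemma code_ltS j p q : (code j p < code j q)%N -> (code j.+1 p < code j.+1 q)%N.
Proof.
elim: j p q => [|j IH] p q //; rewrite (code_cmp j) (code_cmp j.+1).
by case: (ltngtP (f p) (f q)) => //= _; case: barred; apply: IH.
Qed.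

Lemma code_tied j p q : code j p = code j q ->
  forall i, (i < j)%N -> f (p + i) = f (q + i).
Proof.
elim: j p q => [|j IH] p q //; move/code_eq => [e1 /IH h] [|i] lij.
  by rewrite !addn0.
by rewrite !addnS -!addSn h.
Qed.

Lemma code_modr j p q : p = q %[mod r] -> code j p = code j q.
Proof.
elim: j p q => [|j IH] p q h //=.
have -> : f p = f q.
  by rewrite (divn_eq p r) (divn_eq q r) h ![(_ * r + _)%N]addnC !f_perM.
rewrite (IH p.+1 q.+1) // -(addn1 p) -(addn1 q).
by apply/eqP; rewrite eqn_modDr; apply/eqP.
Qed.

(** Rotations are ranked by the codes of their prefixes of length N.  For e = 2,
  ties are broken by a bit that changes at each bar; it is N-periodic because
  two copies of the least period have an even number of bars, and it separates p
  from p + r because one copy has an odd number of bars.  Its value at 0 is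
  free, whence the two rankings. *)
Lemma ranking_exists b : (e = 1%N \/ e = 2%N /\ flips 0 r) ->
  exists2 s, rotation_ranking s & (e = 2%N -> (s 0 < s r)%N = b).
Proof.
(* c is the tie-breaking bit *)
move=> he; pose c p := (e == 2%N) && (~~ b (+) flips 0 p).
pose s p := ((code N p).*2 + c p)%N; exists s; last first.
  move=> e2; rewrite /s /c e2 (@code_modr _ 0 r) ?modnn ?mod0n //=.
  case: he => [|[_ ->]]; first by rewrite e2.
  by rewrite ltn_add2l addbF addbT negbK; case: (b).
have s_lt p q : (s p < s q)%N =
    (code N p < code N q)%N || (code N p == code N q) && ~~ c p && c q.
  by rewrite /s; case: (c p); case: (c q); case: (ltngtP (code N p) (code N q)); lia.
have s_eq p q : s p = s q <-> code N p = code N q /\ c p = c q.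
  split=> [|[h1 h2]]; last by rewrite /s h1 h2.
  rewrite /s => h; have h1 : code N p = code N q by case: (c p) (c q) h => -[]; lia.
  by split=> //; move: h; rewrite h1; case: (c p); case: (c q); lia.
have cS p : e = 2%N -> c p.+1 = c p (+) barred (f p).
  by rewrite /c => ->; rewrite /= add0n addbA.
have c1 p : e = 1%N -> c p = false by rewrite /c => ->.
have N_mod_r p q : p = q %[mod N] -> p = q %[mod r].
  move=> h; rewrite -(modn_dvdm p (dvdn_mulr e (dvdnn r))) -N_eq h N_eq.
  by rewrite modn_dvdm // dvdn_mulr.
have cD p : e = 2%N -> c (p + r)%N = ~~ c p.
  move=> e2; rewrite /c e2 flipsD /= add0n flips_period.
  by case: he => [|[_ ->]]; [rewrite e2 | rewrite addbA addbT].
have cN p q : p = q %[mod N] -> c p = c q.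
  case: he => [e1 | [e2 _]]; first by rewrite !c1.
  have cM x y : c (x + y * N)%N = c x.
    elim: y => [|y IH]; first by rewrite addn0.
    by rewrite mulSnr addnA -[RHS]IH {2}N_eq e2 muln2 -addnn addnA !cD // negbK.
  by move=> h; rewrite (divn_eq p N) (divn_eq q N) h ![(_ * N + _)%N]addnC !cM.
split=> p q.
  rewrite s_eq; split=> [[h1 h2] | h]; last first.
    by split; [apply: code_modr; apply: N_mod_r | apply: cN].
  have pqr := tied_mod (code_tied h1).
  case: he => [e1 | [e2 _]]; first by rewrite N_eq e1 muln1.
  have [//|/eqP npq] := eqVneq (p %% N)%N (q %% N)%N.
  by move: h2; rewrite (cN _ _ (half_period e2 npq pqr)) cD //; case: (c p).
rewrite s_lt => /orP[lt | /andP[/andP[/eqP eqc ncp] cq]].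
  have := code_ltS lt; rewrite code_cmp /letter_step.
  case: ltngtP => //= efq; case: barred => lt'.
    by rewrite s_lt lt'.
  by rewrite s_lt ltnNge (ltnW lt') (gtn_eqF lt') .
have e2 : e = 2%N by case: he => [e1|[]//]; rewrite c1 in cq.
have tie := tied_mod (code_tied eqc).
have efq : f p = f q.
  by rewrite (divn_eq p r) (divn_eq q r) tie ![(_ * r + _)%N]addnC !f_perM.
have eS : code N p.+1 = code N q.+1.
  apply: code_modr; rewrite -(addn1 p) -(addn1 q).
  by apply/eqP; rewrite eqn_modDr; apply/eqP.
rewrite /letter_step efq eqxx ltnn s_lt eS ltnn eqxx !cS // efq cq (negPf ncp) /=.
by case: barred.
Qed.

End SignedLexOrder.

(** * The number of rankings of a word *)

Lemma minimal_period (f : nat -> nat) N : (0 < N)%N -> (forall p, f (p + N)%N = f p) ->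
  exists r, [/\ (0 < r)%N, (r %| N)%N, forall p, f (p + r)%N = f p &
    forall l, (forall p, f (p + l)%N = f p) -> (r %| l)%N].
Proof.
move=> N0 fN.
have fM d p x : (forall p, f (p + d)%N = f p) -> f (p + x * d)%N = f p.
  by move=> fd; elim: x => [|x IH]; [rewrite mul0n addn0 | rewrite mulSnr addnA fd].
pose per l := [forall p : 'I_N, f (p + l)%N == f p].
have perP l : reflect (forall p, f (p + l)%N = f p) (per l).
  apply: (iffP forallP) => [h p | h p]; last by rewrite h.
  have /eqP := h (Ordinal (ltn_pmod p N0)); rewrite /= => h'.
  by rewrite (divn_eq p N) -addnA ![(_ * N + _)%N]addnC !fM.
have ex : exists l, (0 < l)%N && per l by exists N; rewrite N0; apply/perP.
case: (ex_minnP ex) => r /andP[r0 /perP fr] rmin.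
have dvd l : (forall p, f (p + l)%N = f p) -> (r %| l)%N.
  move=> fl; rewrite /dvdn; case: posnP => // l0.
  have : (r <= l %% r)%N.
    apply: rmin; rewrite l0; apply/perP => p.
    by rewrite -(fM r _ (l %/ r)%N fr) -addnA [(_ + _ * r)%N]addnC -divn_eq fl.
  by rewrite leqNgt ltn_pmod.
by exists r; split=> //; apply: dvd.
Qed.

Definition cyclic_word n m (w : {ffun 'I_n.+1 -> 'I_m}) (p : nat) : nat :=
  w (inord (p %% n.+1)).

Definition cyclic_rank n (s : 'S_n.+1) (p : nat) : nat := s (inord (p %% n.+1)).

Lemma cyclic_wordE n m (w : {ffun 'I_n.+1 -> 'I_m}) (i : 'I_n.+1) :
  cyclic_word w i = w i.
Proof. by rewrite /cyclic_word modn_small // inord_val. Qed.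

Lemma cyclic_wordD n m (w : {ffun 'I_n.+1 -> 'I_m}) p :
  cyclic_word w (p + n.+1) = cyclic_word w p.
Proof. by rewrite /cyclic_word modnDr. Qed.

(** By [rank_permP], this says that s ranks the rotations of w. *)
Definition rank_perm n m (w : {ffun 'I_n.+1 -> 'I_m}) (s : 'S_n.+1) : bool :=
  compatible (cyclic_shift n ^ s)%g [ffun i => w ((s^-1)%g i)].

Lemma inord_modS n p : cyclic_shift n (inord (p %% n.+1)) = inord (p.+1 %% n.+1).
Proof.
apply: val_inj; rewrite permE /= !inordK ?ltn_pmod // .
by rewrite -[(_ %% _).+1]addn1 modnDml addn1.
Qed.

Lemma cyclic_rank_eq n (s : 'S_n.+1) p q :
  cyclic_rank s p = cyclic_rank s q <-> p = q %[mod n.+1].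
Proof.
rewrite /cyclic_rank; split=> [/val_inj/perm_inj/(congr1 val) /= | -> //].
by rewrite !inordK ?ltn_pmod.
Qed.

Lemma cyclic_rankE n (s : 'S_n.+1) (i : 'I_n.+1) : cyclic_rank s i = s i.
Proof. by rewrite /cyclic_rank modn_small // inord_val. Qed.

Lemma cyclic_rankS n (s : 'S_n.+1) p :
  cyclic_rank s p.+1 = (cyclic_shift n ^ s)%g (s (inord (p %% n.+1))).
Proof. by rewrite permJ inord_modS. Qed.

Lemma rank_permP n m (w : {ffun 'I_n.+1 -> 'I_m}) (s : 'S_n.+1) :
  reflect (rotation_ranking n.+1 (cyclic_word w) (cyclic_rank s)) (rank_perm w s).
Proof.
apply: (iffP forallP) => [h | [_ h] i].
  split=> p q; first exact: cyclic_rank_eq.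
  move=> lpq; have /forallP/(_ (s (inord (q %% n.+1))))/implyP/(_ lpq) :=
    h (s (inord (p %% n.+1))).
  by rewrite !cyclic_rankS !ffunE !permK.
apply/forallP => j; apply/implyP => lij.
have := h ((s^-1)%g i) ((s^-1)%g j).
rewrite !cyclic_rankE !cyclic_rankS !modn_small // !inord_val.
by rewrite !permKV !cyclic_wordE !ffunE; apply.
Qed.

(** For e = 2, the two rankings are told apart by their comparison of the
  positions 0 and r. *)
Lemma card_rank_perm n m (w : {ffun 'I_n.+1 -> 'I_m}) r e :
  (0 < r)%N -> n.+1 = (r * e)%N ->
  (forall p, cyclic_word w (p + r) = cyclic_word w p) ->
  (forall l, (forall p, cyclic_word w (p + l) = cyclic_word w p) -> (r %| l)%N) ->
  #|[set s | rank_perm w s]| =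
    ((e == 1%N) + ((e == 2%N) && flips (cyclic_word w) 0 r).*2)%N.
Proof.
set f := cyclic_word w => r0 eN fr rmin.
have e0 : (0 < e)%N by move: eN; case: e => //; rewrite muln0.
have uniq s t : rank_perm w s -> rank_perm w t ->
   (e = 1%N \/ e = 2%N /\ (s ord0 < s (inord r))%N = (t ord0 < t (inord r))%N) ->
   s = t.
  move=> /rank_permP cs /rank_permP ct h; apply: perm_order_inj => p q.
  have := ranking_unique r0 e0 eN fr rmin cs ct _ p q.
  rewrite !cyclic_rankE /cyclic_rank; apply.
  case: h => [->|[e2 h]]; [by left | right; split => //].
  rewrite !mod0n !modn_small; last by rewrite eN e2; lia.
  by have -> : inord 0 = ord0 :> 'I_n.+1 by apply: val_inj; rewrite /= inordK.
have exist b : (e = 1%N \/ e = 2%N /\ flips f 0 r) ->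
    exists2 t, rank_perm w t & (e = 2%N -> (t ord0 < t (inord r))%N = b).
  move=> he; have f_lt p : (f p < m)%N by apply: ltn_ord.
  have [Y cY hb] := ranking_exists r0 e0 eN fr rmin f_lt b he.
  have [YN YV] := cY.
  have injY : injective (fun i : 'I_n.+1 => Y i).
    by move=> i j /YN; rewrite !modn_small // => /val_inj.
  have [t ht] := sorting_perm_unique injY.
  have Ymod p : Y (p %% n.+1)%N = Y p by apply/YN; rewrite modn_mod.
  have tY p q : (cyclic_rank t p < cyclic_rank t q)%N = (Y p < Y q)%N.
    have tlt : forall i j, (t i < t j)%N -> (Y i < Y j)%N by apply/ht.
    rewrite -(Ymod p) -(Ymod q) /cyclic_rank.
    have ep x : (x %% n.+1)%N = (inord (x %% n.+1) : 'I_n.+1) by rewrite inordK ?ltn_pmod.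
    rewrite [in RHS](ep p) [in RHS](ep q).
    move: (inord _) (inord _) => i j; apply/idP/idP => [/tlt //|].
    case: (ltngtP (t i) (t j)) => // [/tlt|/val_inj/perm_inj ->]; last by rewrite ltnn.
    by case: ltngtP.
  exists t.
    apply/rank_permP; split=> p q; first exact: cyclic_rank_eq.
    by rewrite !tY; apply: YV.
  move=> e2; rewrite -(hb e2) -tY /cyclic_rank mod0n modn_small;
    last by rewrite eN e2; lia.
  by have -> : inord 0 = ord0 :> 'I_n.+1 by apply: val_inj; rewrite /= inordK.
have [e1|ne1] := eqVneq e 1%N.
  have [t vt _] := exist true (or_introl e1).
  rewrite [X in (X == 2)%N]e1 /= addn0; apply/eqP/cards1P; exists t.
  by apply/setP => s; rewrite !inE; apply/idP/eqP => [vs|->//]; apply: uniq => //; left.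
have [/andP[/eqP e2 fl]|nfl] := boolP ((e == 2%N) && flips f 0 r).
  have h : e = 1%N \/ e = 2%N /\ flips f 0 r by right.
  have [t vt bt] := exist true h; have [u vu bu] := exist false h.
  have ntu : t != u by apply: contraTneq isT => etu; move: (bt e2); rewrite etu bu.
  have -> : [set s | rank_perm w s] = [set t; u].
    apply/setP => s; rewrite !inE; apply/idP/orP => [vs|[/eqP->|/eqP->] //].
    by case E : (s ord0 < s (inord r))%N; [left|right]; apply/eqP; apply: uniq => //;
      right; rewrite E ?bt ?bu.
  by rewrite cards2 ntu.
apply/eqP; rewrite cards_eq0 -subset0; apply/subsetP => s; rewrite inE => /rank_permP cs.
case: (ranking_exponent r0 e0 eN fr cs) => [e1|[e2 fl]]; first by rewrite e1 in ne1.
by rewrite e2 fl in nfl.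
Qed.

(** * Counting words compatible with cyclic permutations *)

Definition word_period n m (w : {ffun 'I_n.+1 -> 'I_m}) (l : nat) : bool :=
  [forall p : 'I_n.+1, cyclic_word w (p + l) == cyclic_word w p].

Lemma word_periodP n m (w : {ffun 'I_n.+1 -> 'I_m}) l :
  reflect (forall p, cyclic_word w (p + l) = cyclic_word w p) (word_period w l).
Proof.
apply: (iffP forallP) => [h p | h p]; last by rewrite h.
have /eqP := h (Ordinal (ltn_pmod p (ltn0Sn n))).
by rewrite /= /cyclic_word modnDml modn_mod.
Qed.

(** Let N = n + 1 = re, with r the least period of w.  For d dividing N, the word
  w has period N/d exactly when d divides e.  Then w is made of d copies of its
  first N/d letters, and the signs in (- (- y)^d) become those of
  [mobius_sign_sum]. *)
Lemma weight_card_rank_perm (R : comNzRingType) (y : R) n m (w : {ffun 'I_n.+1 -> 'I_m}) :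
  weight y w * #|[set s | rank_perm w s]|%:R =
  \sum_(d <- divisors n.+1 | word_period w (n.+1 %/ d)) (mobius d)%:~R *
     \prod_(p < n.+1 %/ d) (- (- y) ^+ d) ^+ barred (cyclic_word w p).
Proof.
have [r [r0 /dvdnP[e eN] fr rmin]] :=
  minimal_period (ltn0Sn n) (cyclic_wordD w).
have e0 : (0 < e)%N by move: eN; case: e.
rewrite mulnC in eN; rewrite (card_rank_perm r0 eN fr rmin).
set f := cyclic_word w in fr rmin *; pose B l := (\sum_(p < l) barred (f p))%N.
have fM p x : f (p + x * r)%N = f p.
  by elim: x => [|x IH]; [rewrite mul0n addn0 | rewrite mulSnr addnA fr].
have BM x : B (x * r)%N = (x * B r)%N.
  elim: x => [|x IH]; first by rewrite !mul0n /B big_ord0.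
  rewrite mulSnr /B big_split_ord /= -/(B _) IH mulSnr; congr (_ + _)%N.
  by apply: eq_bigr => i _; rewrite addnC fM.
have Bodd l : flips f 0 l = odd (B l).
  elim: l => [|l IH]; first by rewrite /B big_ord0.
  by rewrite /B big_ord_recr oddD /= IH add0n; case: barred.
have -> : weight y w = y ^+ B n.+1.
  rewrite /weight prodrXr /B; congr (_ ^+ _).
  by apply: eq_bigr => i _; rewrite /f cyclic_wordE.
have st : perm_eq [seq d <- divisors n.+1 | word_period w (n.+1 %/ d)] (divisors e).
  apply: uniq_perm; rewrite ?filter_uniq ?divisors_uniq // => d.
  rewrite mem_filter -!dvdn_divisors //.
  have key : (d %| n.+1)%N -> (r %| n.+1 %/ d)%N = (d %| e)%N.
    by move=> dN; rewrite dvdn_divRL // eN dvdn_pmul2l.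
  apply/andP/idP => [[/word_periodP per dN] | de].
    by rewrite -key //; apply: rmin.
  have dN : (d %| n.+1)%N by rewrite eN dvdn_mull.
  split=> //; apply/word_periodP => p; move: (key dN); rewrite de => /dvdnP[x ->].
  exact: fM.
rewrite -big_filter (perm_big _ st) Bodd.
rewrite -[X in _ * X](rmorph_nat (intmul (1 : R))) -mobius_sign_sum //.
rewrite rmorph_sum mulr_sumr; apply: eq_big_seq => d; rewrite -dvdn_divisors // => de.
rewrite prodrXr -/(B _) rmorphM rmorphXn rmorphN1 mulrCA; congr (_ * _).
have -> : (n.+1 %/ d = e %/ d * r)%N by rewrite eN -muln_divA // mulnC.
rewrite BM -[- (- y) ^+ d]mulN1r exprMn -exprM.
have -> : (d * (e %/ d * B r) = B n.+1)%N.
  by rewrite eN mulnC [(r * e)%N]mulnC BM mulnAC divnK.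
rewrite [(- y) ^+ _]exprNn mulrA -exprD mulrC; congr (_ * _).
rewrite eN [(r * e)%N]mulnC BM -mulnDl.
by rewrite -signr_odd -[RHS]signr_odd !oddM [LHS]/= oddb andbC.
Qed.

Lemma periodic_words_sum (R : comNzRingType) (z : R) n k l :
  (0 < l)%N -> (l %| n.+1)%N ->
  \sum_(w : {ffun 'I_n.+1 -> 'I_(k.*2)} | word_period w l)
     \prod_(p < l) z ^+ barred (cyclic_word w p)
  = (k%:R * (1 + z)) ^+ l.
Proof.
move=> l0 lN; have leN : (l <= n.+1)%N by apply: dvdn_leq.
pose h (v : {ffun 'I_l -> 'I_(k.*2)}) : {ffun 'I_n.+1 -> 'I_(k.*2)} :=
  [ffun i : 'I_n.+1 => v (Ordinal (ltn_pmod i l0))].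
pose h' (w : {ffun 'I_n.+1 -> 'I_(k.*2)}) : {ffun 'I_l -> 'I_(k.*2)} :=
  [ffun j : 'I_l => w (widen_ord leN j)].
have hE v p : cyclic_word (h v) p = v (Ordinal (ltn_pmod p l0)).
  rewrite /cyclic_word ffunE; congr (nat_of_ord (v _)); apply: val_inj.
  by rewrite /= inordK ?ltn_pmod // modn_dvdm.
have hK v : h' (h v) = v.
  apply/ffunP => j; rewrite !ffunE; congr (v _); apply: val_inj.
  by rewrite /= modn_small.
rewrite -words_sum (reindex_onto h h') /=.
  apply: eq_big => [v | v _].
    rewrite hK eqxx andbT; apply/word_periodP => p.
    rewrite !hE; congr (nat_of_ord (v _)); apply: val_inj.
    by rewrite /= modnDr.
  apply: eq_bigr => i _; rewrite hE; congr (_ ^+ barred (v _)); apply: val_inj.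
  by rewrite /= modn_small.
move=> w /word_periodP per; apply/ffunP => i; rewrite !ffunE.
apply: val_inj; rewrite /= -!cyclic_wordE /=.
rewrite [in RHS](divn_eq i l) addnC.
by elim: (i %/ l)%N => [|x IH]; [rewrite mul0n addn0 | rewrite mulSnr addnA per].
Qed.

(** Both sides count words w, weighted by the number of their rankings: on the
  left by [sum_conj_shift], on the right by [weight_card_rank_perm]. *)
Lemma cyclic_compat_sum (R : comNzRingType) (y : R) n k :
  n.+1%:R * \sum_(s : 'S_n.+1 | cyclic_perm s) compat_sum y s k =
  \sum_(d <- divisors n.+1) (mobius d)%:~R *
     (k%:R * (1 - (- y) ^+ d)) ^+ (n.+1 %/ d).
Proof.
rewrite -(sum_conj_shift (fun s => compat_sum y s k)).
rewrite (eq_bigr _ (fun s _ => compat_sum_conj y (cyclic_shift n ^ s)%g (s^-1)%g k)).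
rewrite (exchange_big_dep xpredT) //=.
transitivity (\sum_(w : {ffun 'I_n.+1 -> 'I_(k.*2)})
    weight y w * #|[set s | rank_perm w s]|%:R).
  apply: eq_bigr => w _; rewrite mulr_natr -sumr_const.
  by apply: eq_bigl => s; rewrite inE.
rewrite (eq_bigr _ (fun w _ => weight_card_rank_perm y w)).
rewrite (exchange_big_dep xpredT) //=; apply: eq_big_seq => d.
rewrite -dvdn_divisors // => dN; rewrite -mulr_sumr; congr (_ * _).
rewrite periodic_words_sum //; last by rewrite -{2}(divnK dN) dvdn_mulr.
by rewrite divn_gt0 ?(dvdn_gt0 (ltn0Sn n) dN) // dvdn_leq.
Qed.

(** * The substitution *)

(** The two sides are numerators of the same series over (1-X)^(n+2).  The power
  of 1 - X on the right compensates for the smaller denominator of the series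
  of k^((n+1)/d). *)
Lemma cyclic_pkdes_poly (R : comNzRingType) (y : R) n :
  n.+1%:R * \sum_(s : 'S_n.+1 | cyclic_perm s) pkdes_poly y s =
  \sum_(d <- divisors n.+1) ((mobius d)%:~R *
     (1 - (- y) ^+ d) ^+ (n.+1 %/ d))%:P
     * (1 - 'X) ^+ (n.+1 - n.+1 %/ d) * eulerian (n.+1 %/ d) 'X.
Proof.
have N0 := ltn0Sn n.
pose a k : R := n.+1%:R * \sum_(s : 'S_n.+1 | cyclic_perm s) compat_sum y s k.
apply: (@series_of_inj _ n.+2 _ _ a).
  rewrite -[n.+1%:R]polyC_natr; apply: series_ofZ.
  exact: series_of_sum (fun s _ => compat_sum_series y s).
apply: (@series_of_ext _ _ _ (fun k => \sum_(d <- divisors n.+1)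
    ((mobius d)%:~R * (1 - (- y) ^+ d) ^+ (n.+1 %/ d)) * k%:R ^+ (n.+1 %/ d))).
  move=> k; rewrite /a cyclic_compat_sum; apply: eq_bigr => d _.
  by rewrite exprMn -mulrA [X in _ * X]mulrC.
apply: series_of_sum => d; rewrite -dvdn_divisors // => dN.
have q0 : (0 < n.+1 %/ d)%N by rewrite divn_gt0 ?(dvdn_gt0 N0 dN) // dvdn_leq.
have qN : (n.+1 %/ d <= n.+1)%N by apply: leq_div.
rewrite -mulrA [X in _ * X]mulrC; apply: series_ofZ.
rewrite -{1}(subnKC qN) -addSn; apply: series_ofX.
by rewrite -{1 2 3}(prednK q0); apply: eulerian_series.
Qed.

Lemma substitution_cancel (F : fieldType) (A u v : F) p b c :
  u != 0 -> v != 0 ->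
  (A / (u * v)) ^+ p.+1 * (u / v) ^+ (p + b).+1 * v ^+ (p + b + p + c).+2
  = A ^+ p.+1 * u ^+ b * v ^+ c.
Proof.
move=> nu nv; rewrite !expr_div_n exprMn.
have -> : (p + b).+1 = (p.+1 + b)%N by lia.
have -> : (p + b + p + c).+2 = (p.+1 + (p.+1 + b) + c)%N by lia.
rewrite !exprD; field.
by rewrite !expf_neq0 // mulf_neq0 ?expf_neq0.
Qed.

Lemma pkdes_substitution (F : fieldType) (y t : F) n (s : 'S_n.+1) :
  y + t != 0 -> 1 + y * t != 0 ->
  ((1 + y) ^+ 2 * t / ((y + t) * (1 + y * t))) ^+ (pk s).+1 *
    ((y + t) / (1 + y * t)) ^+ (des s).+1 * (1 + y * t) ^+ n.+2
  = (1 + y) * (pkdes_poly y s).[t].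
Proof.
move=> nu nv.
have := substitution_cancel ((1 + y) ^+ 2 * t) (pk s) (des s - pk s)
  (n - des s - pk s) nu nv.
rewrite subnKC ?pk_le_des // -subnDA subnKC ?des_add_pk // => ->.
rewrite /pkdes_poly !(hornerM, horner_exp, hornerD, hornerZ, hornerC, hornerX) subnDA /=.
by rewrite exprSr; ring.
Qed.

Lemma clear_denominators (F : fieldType) (L x c m v : F) :
  m != 0 -> v != 0 -> L * v = x * c -> L = x / (m * v) * (m * c).
Proof. by move=> nm nv e; rewrite -[L](mulfK nv) e; field; rewrite nm nv. Qed.

Lemma eulerian_horner (R : comNzRingType) n (t : R) :
  (eulerian n ('X : {poly R})).[t] = eulerian n t.
Proof. by rewrite /eulerian horner_sum; apply: eq_bigr => s _; rewrite hornerXn. Qed.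

Lemma cyc_pkdes_field (F : fieldType) (y t : F) n :
  n.+1%:R != 0 :> F -> y + t != 0 -> 1 + y * t != 0 ->
  cyc_pkdes n.+1 ((1 + y) ^+ 2 * t / ((y + t) * (1 + y * t))) ((y + t) / (1 + y * t))
  = (1 + y) / (n.+1%:R * (1 + y * t) ^+ n.+2)
    * \sum_(d <- divisors n.+1)
        (mobius d)%:~R * (1 - (- y) ^+ d) ^+ (n.+1 %/ d)
        * (1 - t) ^+ (n.+1 - n.+1 %/ d) * eulerian (n.+1 %/ d) t.
Proof.
move=> char0 nu nv.
have hL : cyc_pkdes n.+1 ((1 + y) ^+ 2 * t / ((y + t) * (1 + y * t)))
      ((y + t) / (1 + y * t)) * (1 + y * t) ^+ n.+2
    = (1 + y) * \sum_(s : 'S_n.+1 | cyclic_perm s) (pkdes_poly y s).[t].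
  rewrite /cyc_pkdes mulr_suml mulr_sumr; apply: eq_bigr => s _.
  exact: pkdes_substitution.
have hR := congr1 (fun P : {poly F} => P.[t]) (cyclic_pkdes_poly y n).
rewrite /= -[n.+1%:R]polyC_natr hornerCM !horner_sum in hR.
have {}hR : n.+1%:R * \sum_(s : 'S_n.+1 | cyclic_perm s) (pkdes_poly y s).[t] =
   \sum_(d <- divisors n.+1) (mobius d)%:~R * (1 - (- y) ^+ d) ^+ (n.+1 %/ d)
      * (1 - t) ^+ (n.+1 - n.+1 %/ d) * eulerian (n.+1 %/ d) t.
  rewrite hR; apply: eq_bigr => d _; rewrite -mulrA hornerCM hornerM -mulrA.
  by rewrite eulerian_horner !(horner_exp, hornerD, hornerN, hornerC, hornerX).
rewrite -hR; apply: clear_denominators => //; exact: expf_neq0.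
Qed.

(** Evaluation at y = t = 1 suffices to see that the denominators of the theorem
  are nonzero. *)
Lemma tofrac_neq0 (P : {mpoly rat[2]}) : P.@[fun=> 1] != 0 -> tofrac P != 0 :> ratfun2.
Proof. by apply: contraNneq => /eqP; rewrite tofrac_eq0 => /eqP ->; rewrite meval0. Qed.

Theorem theorem4p1 (n : nat) (n_gt0 : (0 < n)%N) :
  let y := ratfun_y in
  let t := ratfun_t in
  cyc_pkdes n ((1 + y) ^+ 2 * t / ((y + t) * (1 + y * t))) ((y + t) / (1 + y * t))
  = (1 + y) / (n%:R * (1 + y * t) ^+ n.+1)
    * \sum_(d <- divisors n)
        (mobius d)%:~R * (1 - (- y) ^+ d) ^+ (n %/ d)
        * (1 - t) ^+ (n - n %/ d) * eulerian (n %/ d) t.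
Proof.
case: n n_gt0 => // n _ y t.
have char0 : n.+1%:R != 0 :> ratfun2.
  have -> : n.+1%:R = tofrac (n.+1%:R : {mpoly rat[2]}) by rewrite rmorph_nat.
  by apply: tofrac_neq0; rewrite rmorph_nat Num.Theory.pnatr_eq0.
have nu : y + t != 0.
  rewrite /y /t /ratfun_y /ratfun_t -tofracD; apply: tofrac_neq0.
  by rewrite mevalD !mevalXU.
have nv : 1 + y * t != 0.
  rewrite /y /t /ratfun_y /ratfun_t -tofracM -tofrac1 -tofracD; apply: tofrac_neq0.
  by rewrite mevalD mevalM !mevalXU meval1.
exact: cyc_pkdes_field.
Qed.
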